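(* Let $P\subset\mathbb{R}^n$ be the intersection of an affine subspace of $\mathbb{R}^n$ with the unit cube $\{0\le\xi_j\le1: j=1,\dots,n\}$. Suppose $P$ contains a point $y=(\eta_1,\dots,\eta_n)$ with $0<\eta_j<1$ for $j=1,\dots,n$. Then the strictly concave function $$h(x)=\sum_{j=1}^n\Big(\xi_j\ln\frac1{\xi_j}+(1-\xi_j)\ln\frac1{1-\xi_j}\Big),\qquad x=(\xi_1,\dots,\xi_n),$$ attains its maximum value on $P$ at a unique point $z=(\zeta_1,\dots,\zeta_n)$ with $0<\zeta_j<1$ for $j=1,\dots,n$. Moreover, if $x_1,\dots,x_n$ are independent Bernoulli random variables with $\mathbf{E}\,x_j=\zeta_j$ and $X=(x_1,\dots,x_n)$, then the probability mass function of $X$ is constant on $P\cap\{0,1\}^n$ and equals $e^{-h(z)}$ at every $x\in P\cap\{0,1\}^n$. In particular $|P\cap\{0,1\}^n|=e^{h(z)}\,\mathbf{Pr}\{X\in P\}$.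
   Context: A Bernoulli random variable with expectation $\zeta\in(0,1)$ takes value $1$ with probability $\zeta$ and $0$ with probability $1-\zeta$. The convention $0\ln(1/0)=0$ is used. *)

(* Defs.v *)
From HB Require Import structures.
From mathcomp Require Import all_boot all_order all_algebra.
From mathcomp Require Import all_classical all_reals all_analysis.

Set Implicit Arguments.
Unset Strict Implicit.
Unset Printing Implicit Defensive.

Import Order.TTheory GRing.Theory Num.Theory.

Local Open Scope classical_set_scope.
Local Open Scope ring_scope.

Definition affine_subspace (R : realType) (n : nat) (A : set 'rV[R]_n) : Prop :=
  exists (a : 'rV[R]_n) (V : {vspace 'rV[R]_n}), A = [set x | x - a \in V].

Definition unit_cube (R : realType) (n : nat) : set 'rV[R]_n :=
  [set x | forall j, 0 <= x 0 j <= 1].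

Definition cube_vertices (R : realType) (n : nat) : set 'rV[R]_n :=
  [set x | forall j, x 0 j = 0 \/ x 0 j = 1].

(* The convention 0 ln (1/0) = 0 holds because of the factor 0. *)
Definition entropy (R : realType) (n : nat) (x : 'rV[R]_n) : R :=
  \sum_(j < n) (x 0 j * ln (1 / x 0 j) + (1 - x 0 j) * ln (1 / (1 - x 0 j))).

Definition strictly_concave_on (R : realType) (n : nat)
    (D : set 'rV[R]_n) (f : 'rV[R]_n -> R) : Prop :=
  forall (x y : 'rV[R]_n) (t : R), D x -> D y -> x <> y -> 0 < t < 1 ->
    t * f x + (1 - t) * f y < f (t *: x + (1 - t) *: y).

Definition maximizer_on (R : realType) (n : nat)
    (D : set 'rV[R]_n) (f : 'rV[R]_n -> R) (z : 'rV[R]_n) : Prop :=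
  D z /\ forall x, D x -> f x <= f z.

Definition bernoulli_RV (d : measure_display) (T : measurableType d)
    (R : realType) (Pr : probability T R) (X : {RV Pr >-> R}) : Prop :=
  exists p : R, [/\ 0 < p < 1,
    Pr (X @^-1` [set 1]) = p%:E & Pr (X @^-1` [set 0]) = (1 - p)%:E].

Definition independent_RVs (d : measure_display) (T : measurableType d)
    (R : realType) (Pr : probability T R) (n : nat)
    (X : 'I_n -> {RV Pr >-> R}) : Prop :=
  forall (J : {set 'I_n}) (B : 'I_n -> set (measurableTypeR R)),
    (forall j, measurable (B j)) ->
    Pr (\bigcap_(j in [set` J]) (X j @^-1` B j)) =
    (\prod_(j in J) Pr (X j @^-1` B j))%E.

Definition random_vector (d : measure_display) (T : measurableType d)
    (R : realType) (Pr : probability T R) (n : nat)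
    (X : 'I_n -> {RV Pr >-> R}) (w : T) : 'rV[R]_n :=
  \row_j X j w.

(* Main.v *)
Require Import Defs.
From HB Require Import structures.
From mathcomp Require Import all_boot all_order all_algebra.
From mathcomp Require Import all_classical all_reals all_analysis.
From mathcomp Require Import measurable_realfun ring lra.

Set Implicit Arguments.
Unset Strict Implicit.
Unset Printing Implicit Defensive.

Import Order.TTheory GRing.Theory Num.Theory.
Import numFieldNormedType.Exports.

Local Open Scope classical_set_scope.
Local Open Scope ring_scope.

(* With l(p) = ln((1-p)/p) the derivative of the binary entropy, Gibbs' inequality
   says that the entropy lies below its tangents at interior points of the cube.
   Comparing a maximizer z on P with z + s (x - z), s -> 0+, gives
   sum_j (x_j - z_j) l(z_j) <= 0; since l is infinite at 0 and 1, taking x = y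
   forces z to be interior, and then both x - z and z - x are admissible
   directions, so the sum vanishes for every x in P. The log-probability of a
   vertex x is sum_j (ln (1 - z_j) - x_j l(z_j)), so by this identity it does not
   change when x is replaced with z, where it equals -h(z). *)

(** * Entropy of one variable: tangents, strict concavity, continuity *)

Section BinaryEntropy.
Context {R : realType}.
Implicit Types a b c p t x : R.

(** As [ln] is 0 at nonpositive arguments, this vanishes for all [x <= 0], which makes it continuous
    on the whole line. *)
Definition nxlnx x := x * ln (1 / x).

Definition binary_entropy p := nxlnx p + nxlnx (1 - p).

(* The derivative of the binary entropy, i.e. minus the logit. *)
Definition nlogit p := ln (1 - p) - ln p.

Lemma nxlnxE x : 0 < x -> nxlnx x = - (x * ln x).
Proof. by move=> x0; rewrite /nxlnx div1r lnV ?posrE// mulrN. Qed.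

(** The right side is the tangent at [c] of [- x ln x]. For [a > 0] the bound is [1 + u < expR u] at
    [u = ln (c / a)], nonzero since [a != c], multiplied by [a]; for [a = 0] it reads [0 < c]. *)
Lemma nxlnx_lt_tangent a c : 0 <= a -> 0 < c -> a != c ->
  nxlnx a < - (a * ln c) + (c - a).
Proof.
rewrite le_eqVlt => /predU1P[<- c0 _|a0 c0 ac].
  by rewrite /nxlnx !mul0r oppr0 add0r addr0.
have ca0 : 0 < c / a by rewrite divr_gt0.
have : ln (c / a) != 0.
  rewrite ln_eq0//; apply: contra ac => /eqP ca1.
  by rewrite -[c](divfK (lt0r_neq0 a0)) ca1 mul1r.
move=> /expR_gt1Dx; rewrite lnK ?posrE// ltr_pdivlMr// ln_div ?posrE//.
rewrite nxlnxE//; lra.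
Qed.

(** Average the tangent bounds for [a] and [b] at the convex combination [c]: the linear terms
    cancel. The tangent exists because [a] and [b], being distinct, are not both 0. *)
Lemma nxlnx_strictly_concave a b t : 0 <= a -> 0 <= b -> a != b -> 0 < t < 1 ->
  t * nxlnx a + (1 - t) * nxlnx b < nxlnx (t * a + (1 - t) * b).
Proof.
move=> a0 b0 ab /andP[t0 t1]; set c := t * a + (1 - t) * b.
have ac : a != c.
  have e : a - c = (1 - t) * (a - b) by rewrite /c; ring.
  by rewrite -subr_eq0 e mulf_neq0 ?subr_eq0// gt_eqF.
have bc : b != c.
  have e : b - c = t * (b - a) by rewrite /c; ring.
  by rewrite -subr_eq0 e mulf_neq0 ?subr_eq0 1?eq_sym// lt_eqF.
have c0 : 0 < c.
  have [a00|a00] := eqVneq a 0.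
    have {}b0 : 0 < b.
      by rewrite lt_neqAle b0 andbT eq_sym; apply: contraNneq ab => ->; rewrite a00.
    rewrite /c; nra.
  have {}a0 : 0 < a by rewrite lt_neqAle eq_sym a00.
  rewrite /c; nra.
have := nxlnx_lt_tangent a0 c0 ac; rewrite -(ltr_pM2l t0) => h1.
have := nxlnx_lt_tangent b0 c0 bc; rewrite -(ltr_pM2l (_ : 0 < 1 - t)) ?subr_gt0//.
move=> h2.
apply: lt_le_trans (ltrD h1 h2) _; rewrite nxlnxE//.
rewrite le_eqVlt; apply/orP; left; apply/eqP.
by move: (ln c) => l; rewrite /c; ring.
Qed.

Lemma binary_entropy_strictly_concave a b t :
  0 <= a <= 1 -> 0 <= b <= 1 -> a != b -> 0 < t < 1 ->
  t * binary_entropy a + (1 - t) * binary_entropy b <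
  binary_entropy (t * a + (1 - t) * b).
Proof.
move=> /andP[a0 a1] /andP[b0 b1] ab t01.
have ab' : 1 - a != 1 - b by rewrite (inj_eq (addrI 1)) eqr_opp.
have h1 := nxlnx_strictly_concave a0 b0 ab t01.
have : t * nxlnx (1 - a) + (1 - t) * nxlnx (1 - b) <
    nxlnx (t * (1 - a) + (1 - t) * (1 - b)).
  by apply: nxlnx_strictly_concave; rewrite ?subr_ge0.
have -> : t * (1 - a) + (1 - t) * (1 - b) = 1 - (t * a + (1 - t) * b) by ring.
by move: h1; rewrite /binary_entropy; lra.
Qed.

Lemma binary_entropyE p : 0 < p < 1 ->
  binary_entropy p = p * nlogit p - ln (1 - p).
Proof.
by move=> /andP[p0 p1]; rewrite /binary_entropy !nxlnxE ?subr_gt0// /nlogit; ring.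
Qed.

(** Gibbs' inequality: add the tangent bounds for [a] at [c] and for [1 - a] at [1 - c]; the
    corrections [c - a] and [a - c] cancel. *)
Lemma binary_entropy_le_tangent a c : 0 <= a <= 1 -> 0 < c < 1 ->
  binary_entropy a <= binary_entropy c + (a - c) * nlogit c.
Proof.
move=> /andP[a0 a1] /andP[c0 c1].
have [->|ac] := eqVneq a c; first by rewrite subrr mul0r addr0.
have ac' : 1 - a != 1 - c by rewrite (inj_eq (addrI 1)) eqr_opp.
have h1 := nxlnx_lt_tangent a0 c0 ac.
have : nxlnx (1 - a) < - ((1 - a) * ln (1 - c)) + ((1 - c) - (1 - a)).
  by apply: nxlnx_lt_tangent; rewrite ?subr_ge0 ?subr_gt0.
rewrite (@binary_entropyE c) ?c0// /binary_entropy /nlogit; lra.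
Qed.

Lemma nlogit_le a b : 0 < a -> a <= b -> b < 1 -> nlogit b <= nlogit a.
Proof.
move=> a0 ab b1; have b0 := lt_le_trans a0 ab; have a1 := le_lt_trans ab b1.
by rewrite lerB// ler_ln ?posrE ?subr_gt0// lerD2l lerN2.
Qed.

Lemma continuous_nlogit p : 0 < p < 1 -> {for p, continuous nlogit}.
Proof.
move=> /andP[p0 p1]; apply: cvgB; last exact: continuous_ln.
apply: continuous_comp; last by apply: continuous_ln; rewrite subr_gt0.
by apply: cvgB; [exact: cvg_cst|exact: cvg_id].
Qed.

Lemma nxlnx_ge0 x : x <= 1 -> 0 <= nxlnx x.
Proof.
have [x0 _|x0 x1] := leP x 0.
  by rewrite /nxlnx ln0 ?mulr0// div1r invr_le0.
by rewrite mulr_ge0 ?(ltW x0)// ln_ge0// div1r invf_ge1.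
Qed.

(** For [x > 0], apply [ln u < u] at [u = (Num.sqrt x)^-1] and multiply by [2 * x]. The bound tends
    to 0 at 0 and gives continuity there. *)
Lemma nxlnx_le_sqrt x : nxlnx x <= 2 * Num.sqrt x.
Proof.
have [x0|x0] := leP x 0.
  by rewrite /nxlnx ln0 ?mulr0 ?mulr_ge0 ?sqrtr_ge0// div1r invr_le0.
have s0 : 0 < Num.sqrt x by rewrite sqrtr_gt0.
have xE : x = Num.sqrt x ^+ 2 by rewrite sqr_sqrtr// ltW.
have := ln_sublinear (_ : 0 < (Num.sqrt x)^-1); rewrite invr_gt0 => /(_ s0).
rewrite lnV ?posrE// -(ltr_pM2l x0) => h.
rewrite nxlnxE// {2}xE lnXn//.
have : x * (Num.sqrt x)^-1 = Num.sqrt x by rewrite {1}xE expr2 mulfK ?lt0r_neq0.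
move: h; rewrite mulr2n => + e; rewrite e; lra.
Qed.

Lemma continuous_nxlnx : continuous nxlnx.
Proof.
move=> x; have [x0|x0] := leP x 0; last first.
  apply: cvgM; first exact: cvg_id.
  apply: continuous_comp; last by apply: continuous_ln; rewrite divr_gt0.
  by apply: cvgM; [exact: cvg_cst|apply: cvgV; [exact: lt0r_neq0|exact: cvg_id]].
rewrite /continuous_at (_ : nxlnx x = 0); last first.
  by rewrite /nxlnx ln0 ?mulr0// div1r invr_le0.
apply: (@squeeze_cvgr _ _ _ _ (cst 0) (fun x => 2 * Num.sqrt x)).
- near=> u; rewrite nxlnx_le_sqrt andbT nxlnx_ge0// ltW//.
  near: u; apply: lt_nbhsl; exact: le_lt_trans x0 ltr01.
- exact: cvg_cst.
- rewrite -[X in _ --> X](mulr0 2); apply: cvgM; first exact: cvg_cst.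
  by have := @sqrt_continuous R x; rewrite /continuous_at (ler0_sqrtr x0).
Unshelve. all: by end_near. Qed.

Lemma continuous_binary_entropy : continuous binary_entropy.
Proof.
move=> p; have h : {for p, continuous (fun q : R => nxlnx (1 - q))}.
  apply: continuous_comp; last exact: continuous_nxlnx.
  by apply: cvgB; [exact: cvg_cst|exact: cvg_id].
exact: cvgD (@continuous_nxlnx p) h.
Qed.

End BinaryEntropy.

(** * Limits of finite sums, affine subspaces and the unit cube *)

Lemma cvg_sumr (R : realType) (T I : Type) (F : set_system T) {FF : Filter F}
    (r : seq I) (f : I -> T -> R) (l : I -> R) :
  (forall i, f i x @[x --> F] --> l i) ->
  \sum_(i <- r) f i x @[x --> F] --> \sum_(i <- r) l i.
Proof. by move=> fl; apply: cvg_big => [|i _]; [exact: add_continuous|exact: fl]. Qed.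

Section AffineSubspace.
Context {R : realType} {n : nat}.
Implicit Types (A : set 'rV[R]_n) (x z : 'rV[R]_n).

(** A subspace is the kernel of the identity minus the projection onto it. Closedness and
    measurability then reduce to finitely many linear equations in the coordinates. *)
Lemma affine_subspace_mulmx A : affine_subspace A ->
  exists (M : 'M[R]_n) (b : 'rV[R]_n), A = [set x | x *m M = b].
Proof.
move=> [a [V ->]]; pose f : 'End('rV[R]_n) := (\1 - projv V)%VF.
have fE x : f x = x - projv V x by rewrite add_lfunE opp_lfunE id_lfunE.
exists (lin1_mx f), (f a); apply/seteqP; split => x /=; rewrite mul_rV_lin1.
  by move=> xaV; apply/eqP; rewrite -subr_eq0 -linearB/= fE projv_id// subrr.
move=> /eqP; rewrite -subr_eq0 -linearB/= fE subr_eq0 => /eqP ->.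
exact: memv_proj.
Qed.

Lemma affine_subspace_line A x z s : affine_subspace A ->
  A x -> A z -> A (z + s *: (x - z)).
Proof.
move=> /affine_subspace_mulmx[M [b ->]] /= xb zb.
by rewrite mulmxDl -scalemxAl mulmxBl xb zb subrr scaler0 addr0.
Qed.

Lemma affine_subspace_closed A : affine_subspace A -> closed A.
Proof.
move=> /affine_subspace_mulmx[M [b ->]].
have -> : [set x | x *m M = b] =
    \bigcap_(i in [set: 'I_n]) [set x | \sum_j x 0 j * M j i = b 0 i].
  apply/seteqP; split => x /=.
    by move=> <- i _ /=; rewrite mxE.
  by move=> h; apply/rowP => i; rewrite mxE; exact: h.
apply: closed_bigI => i _.
have cf : continuous (fun x : 'rV[R]_n => \sum_j x 0 j * M j i).
  move=> x; apply: (@cvg_sumr _ _ _ (nbhs x)) => j.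
  apply: cvgM; last exact: cvg_cst.
  exact: coord_continuous.
exact: (proj1 (continuous_closedP _) cf _ (@closed_eq _ (b 0 i))).
Qed.

Lemma unit_cube_compact : compact (@unit_cube R n).
Proof.
have := @rV_compact R n (fun=> `[0, 1]%classic) (fun=> @segment_compact _ _ _).
congr compact; apply/seteqP; split => x /= h j; have := h j; by rewrite /= in_itv.
Qed.

End AffineSubspace.

(** * Entropy on the cube: existence, uniqueness and interiority of the maximizer *)

Section Entropy.
Context {R : realType} {n : nat}.
Implicit Types (A P : set 'rV[R]_n) (d w x y z : 'rV[R]_n).

Lemma entropyE x : entropy x = \sum_(j < n) binary_entropy (x 0 j).
Proof. by []. Qed.

Lemma continuous_entropy : continuous (@entropy R n).
Proof.
move=> x; apply: (@cvg_sumr _ _ _ (nbhs x)) => j.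
apply: (@continuous_comp _ _ _ (fun x : 'rV[R]_n => x 0 j) binary_entropy).
  exact: coord_continuous.
exact: continuous_binary_entropy.
Qed.

Lemma entropy_strictly_concave :
  strictly_concave_on (@unit_cube R n) (@entropy R n).
Proof.
move=> x y t Cx Cy xy t01; rewrite !entropyE.
have [j xyj] : exists j, x 0 j != y 0 j.
  apply: contrapT => /forallNP h; apply: xy; apply/rowP => j.
  by have /negP := h j; rewrite negbK => /eqP.
have le i : t * binary_entropy (x 0 i) + (1 - t) * binary_entropy (y 0 i) <=
    binary_entropy ((t *: x + (1 - t) *: y) 0 i).
  rewrite !mxE; have [->|xyi] := eqVneq (x 0 i) (y 0 i).
    by rewrite -!mulrDl addrC subrK !mul1r.
  exact/ltW/binary_entropy_strictly_concave.
rewrite !mulr_sumr -big_split/=.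
rewrite (bigD1 j)//= [ltRHS](bigD1 j)//=; apply: ltr_leD.
  by rewrite !mxE; exact: binary_entropy_strictly_concave.
by apply: ler_sum => i _.
Qed.

Lemma entropy_le_tangent x w : unit_cube x -> (forall j, 0 < w 0 j < 1) ->
  entropy x <= entropy w + \sum_j (x 0 j - w 0 j) * nlogit (w 0 j).
Proof.
move=> Cx w01; rewrite !entropyE -big_split/=.
by apply: ler_sum => j _; exact: binary_entropy_le_tangent.
Qed.

(** The tangent is taken at the moved point, not at [z], so that [z] may lie on the boundary of the
    cube. *)
Lemma entropy_line_slope_le0 z d s : unit_cube z -> 0 < s ->
  (forall j, 0 < (z + s *: d) 0 j < 1) -> entropy (z + s *: d) <= entropy z ->
  \sum_j d 0 j * nlogit ((z + s *: d) 0 j) <= 0.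
Proof.
move=> Cz s0 w01 wz; have := le_trans wz (entropy_le_tangent Cz w01).
rewrite lerDl.
have -> : \sum_j (z 0 j - (z + s *: d) 0 j) * nlogit ((z + s *: d) 0 j) =
    - s * \sum_j d 0 j * nlogit ((z + s *: d) 0 j).
  by rewrite mulr_sumr; apply: eq_bigr => j _; rewrite !mxE; ring.
by rewrite mulNr oppr_ge0 pmulr_rle0.
Qed.

Lemma maximizer_exists A P y : affine_subspace A -> P = A `&` @unit_cube R n ->
  P y -> exists z, maximizer_on P (@entropy R n) z.
Proof.
move=> hA PE Py; have cP : compact P.
  rewrite PE setIC; apply: compact_closedI; first exact: unit_cube_compact.
  exact: affine_subspace_closed.
have [||z] := @EVT_max_rV R n (@entropy R n) P _ cP; first by exists y.
  apply: continuous_subspaceT; exact: continuous_entropy.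
rewrite inE => Pz zmax; exists z; split => // x Px; apply: zmax; exact/mem_set.
Qed.

Lemma maximizer_unique A P z z' : affine_subspace A ->
  P = A `&` @unit_cube R n -> maximizer_on P (@entropy R n) z ->
  maximizer_on P (@entropy R n) z' -> z = z'.
Proof.
move=> hA PE [Pz zmax] [Pz' z'max]; apply: contrapT => zz'.
have [[Az Cz] [Az' Cz']] : (A `&` @unit_cube R n) z /\ (A `&` @unit_cube R n) z'.
  by rewrite -PE.
have h2 : 0 < (2^-1 : R) < 1 by rewrite invr_gt0 ltr0n/= invf_lt1 ?ltr1n.
have := entropy_strictly_concave Cz Cz' zz' h2.
(* The midpoint of two distinct maximizers stays in [P] and would have larger entropy than both. *)
set m := _ *: z + _; have : P m.
  rewrite PE; split.
    rewrite (_ : m = z' + 2^-1 *: (z - z')); first exact: affine_subspace_line.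
    by apply/rowP => j; rewrite !mxE; ring.
  by move=> j; rewrite !mxE; have := Cz j; have := Cz' j; lra.
by move=> /zmax; have := zmax _ Pz'; have := z'max _ Pz; lra.
Qed.

(** If [z 0 j] were 0 or 1, a small move from [z] towards [y] would give a positive slope: its
    [j]-th term grows like [- ln s], while the other terms stay bounded below. *)
Lemma maximizer_interior A P y z : affine_subspace A ->
  P = A `&` @unit_cube R n -> P y -> (forall j, 0 < y 0 j < 1) ->
  maximizer_on P (@entropy R n) z -> forall j, 0 < z 0 j < 1.
Proof.
move=> hA PE Py y01 [Pz zmax] j; apply: contrapT => zj.
have [[Ay Cy] [Az Cz]] : (A `&` @unit_cube R n) y /\ (A `&` @unit_cube R n) z.
  by rewrite -PE.
pose c i := (y 0 i - z 0 i) * nlogit (y 0 i).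
pose D := `|y 0 j - z 0 j|.
have zj01 : z 0 j = 0 \/ z 0 j = 1.
  have := Cz j; rewrite !le_eqVlt => /andP[/predU1P[<-|z0]]; first by left.
  by move=> /predU1P[|z1]; [right|case: zj; rewrite z0].
have D0 : 0 < D.
  rewrite normr_gt0 subr_eq0; have := y01 j.
  by case: zj01 => -> /andP[y0 y1]; [rewrite gt_eqF|rewrite lt_eqF].
pose m := (`|\sum_i c i| + 1) / D.
have m0 : 0 < m by rewrite divr_gt0// ltr_wpDl.
(* [m] is large enough for the [j]-th slope at [s = exp(-m)] to exceed what the
   other coordinates can compensate. *)
pose s := expR (- m).
have s0 : 0 < s := expR_gt0 _.
have s1 : s < 1 by rewrite expR_lt1 oppr_lt0.
pose w := z + s *: (y - z).
have w01 i : 0 < w 0 i < 1.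
  by rewrite !mxE; have := y01 i; have := Cz i; nra.
have Pw : P w.
  rewrite PE; split; first exact: affine_subspace_line.
  by move=> i; have /andP[/ltW -> /ltW ->] := w01 i.
have := entropy_line_slope_le0 Cz s0 w01 (zmax _ Pw); rewrite -/w.
apply/negP; rewrite -ltNge.
have dE i : (y - z) 0 i = y 0 i - z 0 i by rewrite !mxE.
have wE i : w 0 i = z 0 i + s * (y 0 i - z 0 i) by rewrite !mxE.
(* [w 0 i] lies between [z 0 i] and [y 0 i] and [nlogit] is decreasing, so each term is at least its
   value at [y]. *)
have g i : c i <= (y - z) 0 i * nlogit (w 0 i).
  have /andP[y0 y1] := y01 i; have /andP[w0 w1] := w01 i.
  rewrite /c dE.
  have [zy|yz] := leP (z 0 i) (y 0 i).
    rewrite ler_wpM2l ?subr_ge0// nlogit_le// wE; nra.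
  rewrite ler_wnM2l ?subr_le0 ?(ltW yz)// nlogit_le// wE; nra.
(* The distance from [w 0 j] to the endpoint [z 0 j] is [s * D], whose logarithm is [ln D - m]; this
   yields the gain [D * m]. *)
have gj : c j + D * m <= (y - z) 0 j * nlogit (w 0 j).
  have /andP[y0 y1] := y01 j; rewrite /c /D /nlogit dE wE.
  have lnS u : 0 < u -> ln (s * u) = - m + ln u.
    by move=> u0; rewrite lnM ?posrE// expRK.
  case: zj01 => ->.
    rewrite add0r !subr0 lnS// gtr0_norm//.
    have : ln (1 - y 0 j) <= ln (1 - s * y 0 j).
      by rewrite ler_ln ?posrE; nra.
    nra.
  have -> : 1 - (1 + s * (y 0 j - 1)) = s * (1 - y 0 j) by ring.
  rewrite lnS ?subr_gt0// ltr0_norm ?subr_lt0//.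
  have : ln (y 0 j) <= ln (1 + s * (y 0 j - 1)).
    by rewrite ler_ln ?posrE; nra.
  nra.
have : \sum_i c i + D * m <= \sum_i (y - z) 0 i * nlogit (w 0 i).
  rewrite (bigD1 j)//= [leRHS](bigD1 j)//= addrAC; apply: lerD => //.
  by apply: ler_sum.
(* Here [D * m] is the absolute value of [\sum_i c i] plus 1, so the lower bound is at least 1. *)
apply: lt_le_trans; rewrite /m mulrC divfK ?gt_eqF//.
by have := ler_norm (- \sum_i c i); rewrite normrN; lra.
Qed.

(** Let [s] tend to 0 from the right in [entropy_line_slope_le0]: as [z] is interior, [z + s *: d]
    stays in the cube for small [s], and [nlogit] is continuous there. *)
Lemma maximizer_slope_le0 A P z d : P = A `&` @unit_cube R n ->
  maximizer_on P (@entropy R n) z -> (forall j, 0 < z 0 j < 1) ->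
  (forall s, A (z + s *: d)) -> \sum_j d 0 j * nlogit (z 0 j) <= 0.
Proof.
move=> PE [Pz zmax] z01 Ad.
have [Az Cz] : (A `&` @unit_cube R n) z by rewrite -PE.
pose F (s : R) := \sum_j d 0 j * nlogit ((z + s *: d) 0 j).
have line j : (z + s *: d) 0 j @[s --> (0 : R)] --> z 0 j.
  have -> : (fun s : R => (z + s *: d) 0 j) = (fun s => z 0 j + s * d 0 j).
    by apply/funext => s; rewrite !mxE.
  rewrite -[X in _ --> X]addr0 -[X in _ --> _ + X](mul0r (d 0 j)).
  apply: cvgD; first exact: cvg_cst.
  by apply: cvgM; [exact: cvg_id|exact: cvg_cst].
have F0 : F s @[s --> (0 : R)] --> \sum_j d 0 j * nlogit (z 0 j).
  apply: cvg_sumr => j; apply: cvgM; first exact: cvg_cst.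
  exact: (@cvg_comp _ _ _ (fun s : R => (z + s *: d) 0 j) (@nlogit R) _ _ _
    (line j) (continuous_nlogit (z01 j))).
have w01 : \forall s \near (0 : R), forall j, 0 < (z + s *: d) 0 j < 1.
  apply: (@filter_forall _ _ (fun j s => 0 < (z + s *: d) 0 j < 1)
    (nbhs (0 : R)) _) => j.
  have /andP[z0 z1] := z01 j.
  near=> s; apply/andP; split; near: s.
    exact: cvgr_gt (line j) _ z0.
  exact: cvgr_lt (line j) _ z1.
apply: (cvgr_to_le (cvg_at_right_filter F0)).
near=> s; have s0 : 0 < s by near: s; exact: nbhs_right_gt.
have ws : forall j, 0 < (z + s *: d) 0 j < 1.
  by near: s; exact: cvg_within w01.
apply: entropy_line_slope_le0 => //; apply: zmax; rewrite PE; split => // j.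
by have /andP[/ltW -> /ltW ->] := ws j.
Unshelve. all: by end_near. Qed.

End Entropy.

(** * First-order condition on [P] and the mass of a vertex *)

Lemma maximizer_stationary (R : realType) (n : nat) (A P : set 'rV[R]_n)
    (x z : 'rV[R]_n) : affine_subspace A -> P = A `&` @unit_cube R n ->
  maximizer_on P (@entropy R n) z -> (forall j, 0 < z 0 j < 1) -> P x ->
  \sum_j (x 0 j - z 0 j) * nlogit (z 0 j) = 0.
Proof.
move=> hA PE zmax z01 Px.
have [[Ax _] [Az _]] : (A `&` @unit_cube R n) x /\ (A `&` @unit_cube R n) z.
  by rewrite -PE; split => //; case: zmax.
have h1 : \sum_j (x - z) 0 j * nlogit (z 0 j) <= 0.
  by apply: (maximizer_slope_le0 PE zmax z01) => s; exact: affine_subspace_line.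
have h2 : \sum_j (z - x) 0 j * nlogit (z 0 j) <= 0.
  apply: (maximizer_slope_le0 PE zmax z01) => s.
  by rewrite -opprB scalerN -scaleNr; exact: affine_subspace_line.
have e1 : \sum_j (x - z) 0 j * nlogit (z 0 j) =
    \sum_j (x 0 j - z 0 j) * nlogit (z 0 j).
  by apply: eq_bigr => j _; rewrite !mxE.
have e2 : \sum_j (z - x) 0 j * nlogit (z 0 j) =
    - \sum_j (x 0 j - z 0 j) * nlogit (z 0 j).
  by rewrite -sumrN; apply: eq_bigr => j _; rewrite !mxE; ring.
by apply/eqP; rewrite eq_le -{1}e1 h1 -oppr_le0 -e2.
Qed.

(** Every [u] other than 1 receives [1 - p]; the value is a Bernoulli mass only at 0 and 1. *)
Definition bernoulli_mass (R : realType) (p u : R) : R :=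
  if u == 1 then p else 1 - p.

Lemma prod_bernoulli_mass_maximizer (R : realType) (n : nat)
    (A P : set 'rV[R]_n) (x z : 'rV[R]_n) :
  affine_subspace A -> P = A `&` @unit_cube R n ->
  maximizer_on P (@entropy R n) z -> (forall j, 0 < z 0 j < 1) ->
  (P `&` @cube_vertices R n) x ->
  \prod_j bernoulli_mass (z 0 j) (x 0 j) = expR (- entropy z).
Proof.
move=> hA PE zmax z01 [Px Vx].
(* On the values 0 and 1 the log-mass is an affine function of the coordinate. *)
have mass j : bernoulli_mass (z 0 j) (x 0 j) =
    expR (ln (1 - z 0 j) - x 0 j * nlogit (z 0 j)).
  have /andP[z0 z1] := z01 j; rewrite /bernoulli_mass /nlogit.
  case: (Vx j) => ->.
    by rewrite eq_sym oner_eq0 mul0r subr0 lnK// posrE subr_gt0.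
  by rewrite eqxx mul1r opprB addrCA subrr addr0 lnK.
rewrite (eq_bigr _ (fun j _ => mass j)) -expR_sum; congr expR.
rewrite entropyE -sumrN.
have := maximizer_stationary hA PE zmax z01 Px.
(* The two exponents differ by minus the sum that [st] makes vanish. *)
move=> st; apply/eqP; rewrite -subr_eq0 -oppr_eq0 -[X in _ == X]st -sumrB -sumrN.
by apply/eqP/eq_bigr => j _; rewrite binary_entropyE//; ring.
Qed.

Lemma finite_cube_vertices (R : realType) (n : nat) :
  finite_set (@cube_vertices R n).
Proof.
pose f (b : {ffun 'I_n -> bool}) : 'rV[R]_n := \row_j (b j)%:R.
apply: (@sub_finite_set _ _ (f @` setT)); last exact: finite_image.
move=> x Vx; exists [ffun j => x 0 j == 1] => //.
apply/rowP => j; rewrite !mxE ffunE.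
by case: (Vx j) => ->; rewrite ?eqxx// eq_sym oner_eq0.
Qed.

(** * Random vectors with Bernoulli coordinates *)

Section RandomVector.
Context {d : measure_display} {T : measurableType d} {R : realType}.
Variable (Pr : probability T R).

Lemma measurable_RV_preimage (X : {RV Pr >-> R}) (B : set R) :
  measurable B -> measurable (X @^-1` B).
Proof. by move=> mB; rewrite -[_ @^-1` _]setTI; exact: measurable_funP. Qed.

(** The masses at 0 and 1 add up to 1, so the remaining event is null. *)
Lemma bernoulli_RV_ae (X : {RV Pr >-> R}) : bernoulli_RV X ->
  {ae Pr, forall w, X w = 0 \/ X w = 1}.
Proof.
move=> [p [_ X1 X0]]; pose B := X @^-1` [set 0; 1].
have mX r : measurable (X @^-1` [set r]) by exact: measurable_RV_preimage.
have mB : measurable B by apply: measurable_RV_preimage; exact: measurableU.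
have PB : Pr B = (Pr (X @^-1` [set 0%R]) + Pr (X @^-1` [set 1%R]))%E.
  rewrite /B preimage_setU measureU//.
  by apply/seteqP; split => // w /= [-> /eqP]; rewrite eq_sym oner_eq0.
exists (~` B); split; [exact: measurableC| |by move=> w].
by rewrite probability_setC// PB X0 X1 -EFinD subrK subrr.
Qed.

(** The parameter [q] hidden in [bernoulli_RV] is the expectation, because [X] equals the indicator
    of the event [X = 1] almost everywhere. *)
Lemma bernoulli_RV_mass (X : {RV Pr >-> R}) p u : bernoulli_RV X ->
  ('E_Pr[X] = p%:E)%E -> u = 0 \/ u = 1 ->
  Pr (X @^-1` [set u]) = (bernoulli_mass p u)%:E.
Proof.
move=> hX Ep; have := bernoulli_RV_ae hX; case: hX => q [_ X1 X0] X01.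
have m1 : measurable (X @^-1` [set 1]) by exact: measurable_RV_preimage.
suff -> : p = q.
  rewrite /bernoulli_mass => -[->|->]; last by rewrite eqxx.
  by rewrite eq_sym oner_eq0.
apply: EFin_inj; rewrite -Ep -X1 -(expectation_indic Pr m1) !unlock.
apply: ae_eq_integral => //.
- by apply/measurable_EFinP; exact: measurable_funP.
- by apply/measurable_EFinP; exact: measurable_indic.
apply: filterS X01 => w /= Xw _; rewrite indicE; congr EFin.
case: Xw => Xw; last by rewrite mem_set.
by rewrite Xw memNset//= Xw => /eqP; rewrite eq_sym oner_eq0.
Qed.

Context {n : nat}.
Variable X : 'I_n -> {RV Pr >-> R}.

Lemma measurable_random_vector_preimage (A : set 'rV[R]_n) :
  affine_subspace A ->
  measurable (random_vector X @^-1` (A `&` @unit_cube R n)).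
Proof.
move=> /affine_subspace_mulmx[M [b ->]].
pose L i w := \sum_j X j w * M j i.
have -> : random_vector X @^-1` ([set x | x *m M = b] `&` @unit_cube R n) =
    \bigcap_(i in [set: 'I_n]) (L i @^-1` [set b 0 i]) `&`
    \bigcap_(j in [set: 'I_n]) (X j @^-1` `[0, 1]).
  apply/seteqP; split => w /= [h1 h2]; split.
  - by move=> i _ /=; rewrite -h1 mxE; apply: eq_bigr => j _; rewrite mxE.
  - by move=> j _ /=; have := h2 j; rewrite mxE in_itv.
  - apply/rowP => i; rewrite mxE -(h1 i)//.
    by apply: eq_bigr => j _; rewrite mxE.
  - by move=> j; rewrite mxE; have := h2 j Logic.I; rewrite /= in_itv.
apply: measurableI; apply: fin_bigcap_measurable => // i _.
  have mL : measurable_fun setT (L i).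
    by apply: measurable_sum => j; exact: measurable_funM.
  by rewrite -[_ @^-1` _]setTI; exact: mL.
exact: measurable_RV_preimage.
Qed.

(** The intersection runs over the full finite set of indices, to match the form of
    [independent_RVs]. *)
Lemma random_vector_preimage1 (x : 'rV[R]_n) :
  random_vector X @^-1` [set x] =
  \bigcap_(j in [set` [set: 'I_n]%SET]) (X j @^-1` [set x 0 j]).
Proof.
apply/seteqP; split => w /=; first by move=> <- j _ /=; rewrite mxE.
by move=> h; apply/rowP => j; rewrite mxE; apply: h; rewrite /= inE.
Qed.

Lemma measurable_random_vector_preimage1 (x : 'rV[R]_n) :
  measurable (random_vector X @^-1` [set x]).
Proof.
rewrite random_vector_preimage1; exact: fin_bigcap_measurable.
Qed.

Lemma bernoulli_vector_mass (z x : 'rV[R]_n) : independent_RVs X ->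
  (forall j, bernoulli_RV (X j)) -> (forall j, ('E_Pr[X j] = (z 0 j)%:E)%E) ->
  cube_vertices x ->
  Pr (random_vector X @^-1` [set x]) =
  (\prod_j bernoulli_mass (z 0 j) (x 0 j))%:E.
Proof.
move=> indX bX EX Vx; rewrite random_vector_preimage1.
rewrite (indX _ (fun j => [set x 0 j]))//.
rewrite -prodEFin; apply: eq_big => [j|j _]; first by rewrite inE.
exact: bernoulli_RV_mass.
Qed.

Lemma bernoulli_vector_ae : (forall j, bernoulli_RV (X j)) ->
  {ae Pr, forall w, cube_vertices (random_vector X w)}.
Proof.
move=> bX; have h := @filter_forall _ _ (fun j w => X j w = 0 \/ X j w = 1)
  _ (ae_filter_ringOfSetsType Pr) (fun j => bernoulli_RV_ae (bX j)).
by apply: filterS h => w Xw j; rewrite mxE.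
Qed.

(** Almost surely the vector is a vertex, so up to a null set the event is the disjoint union [S] of
    finitely many point events. *)
Lemma bernoulli_vector_Pr (P : set 'rV[R]_n) : (forall j, bernoulli_RV (X j)) ->
  measurable (random_vector X @^-1` P) ->
  Pr (random_vector X @^-1` P) =
  (\sum_(x \in P `&` @cube_vertices R n) Pr (random_vector X @^-1` [set x]))%E.
Proof.
move=> bX mP; set D := P `&` _.
have fD : finite_set D by apply: finite_setIr; exact: finite_cube_vertices.
pose S := \bigcup_(x in D) (random_vector X @^-1` [set x]).
have mS : measurable S.
  by apply: fin_bigcup_measurable => // x _;
    exact: measurable_random_vector_preimage1.
rewrite -measure_fin_bigcup//; first last.
- by move=> x _; exact: measurable_random_vector_preimage1.
- by move=> x y _ _ [w [/= -> ->]].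
have -> : random_vector X @^-1` P = S `|` (random_vector X @^-1` P `\` S).
  rewrite setDUK// => w [x [Px _] /=  -> //].
rewrite measureU0//; first exact: measurableD.
apply/negligibleP; first exact: measurableD.
apply: negligibleS (bernoulli_vector_ae bX) => w [/= Pw Sw] Vw.
by apply: Sw; exists (random_vector X w).
Qed.

End RandomVector.

Theorem theorem3p3 (R : realType) (n : nat) (A P : set 'rV[R]_n)
    (hA : affine_subspace A)
    (hP : P = A `&` @unit_cube R n)
    (y : 'rV[R]_n) (hyP : P y) (hy : forall j, 0 < y 0 j < 1) :
  strictly_concave_on (@unit_cube R n) (@entropy R n) /\
  exists z : 'rV[R]_n,
    [/\ unique (maximizer_on P (@entropy R n)) z,
        forall j, 0 < z 0 j < 1 &
        forall (d : measure_display) (T : measurableType d)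
               (Pr : probability T R) (X : 'I_n -> {RV Pr >-> R}),
          independent_RVs X ->
          (forall j, bernoulli_RV (X j)) ->
          (forall j, ('E_Pr[X j] = (z 0 j)%:E)%E) ->
          (forall x : 'rV[R]_n, (P `&` @cube_vertices R n) x ->
             Pr (random_vector X @^-1` [set x]) = (expR (- entropy z))%:E) /\
          counting (P `&` @cube_vertices R n) =
            ((expR (entropy z))%:E * Pr (random_vector X @^-1` P))%E].
Proof.
split; first exact: entropy_strictly_concave.
have [z zmax] := maximizer_exists hA hP hyP.
have z01 := maximizer_interior hA hP hyP hy zmax.
exists z; split => //.
  by split => // z'; exact: maximizer_unique hA hP zmax.
move=> d T Pr X indX bX EX; set D := P `&` _.
have pmf x : D x -> Pr (random_vector X @^-1` [set x]) = (expR (- entropy z))%:E.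
  move=> Dx; rewrite (bernoulli_vector_mass indX bX EX); last by case: Dx.
  by rewrite (prod_bernoulli_mass_maximizer hA hP zmax z01 Dx).
split => //.
have fD : finite_set D by apply: finite_setIr; exact: finite_cube_vertices.
rewrite bernoulli_vector_Pr//; last first.
  by rewrite hP; exact: measurable_random_vector_preimage.
rewrite (eq_fsbigr (fun=> (expR (- entropy z))%:E)); last first.
  by move=> x /set_mem; exact: pmf.
(* A constant sum over the finite set [D] is its cardinality times [expR (- entropy z)]; the
   exponentials then cancel. *)
rewrite fsbig_finite//= sumEFin big_const_seq count_predT iter_addr_0.
rewrite -EFinM -mulr_natr mulrA -expRD subrr expR0 mul1r.
by rewrite /counting asboolT.
Qed.
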